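(* Let $\tau:[0,\infty)\to[0,\infty)$ be continuous with $\lim_{t\to\infty}\{t-\tau(t)\}=\infty$, let $-\bar{\tau}=\inf_{t\ge 0}\{t-\tau(t)\}$, and suppose $\lim_{t\to\infty}\tau(t)/t=q$ for some $q\in(0,1)$. Let $g:[0,\infty)\to[0,\infty)$ be continuous with $g(0)=0$, $g(x)>0$ for $x>0$, such that there is $\delta_1>0$ for which $g$ is increasing on $(0,\delta_1)$, and there is $\beta>1$ with $g\in\mathrm{RV}_0(\beta)$. Let $a>b>0$ obey $$a>b\left(\frac{1}{1-q}\right)^{\beta/(\beta-1)}>0,$$ and define $$\Lambda=\left(a-b\left(\frac{1}{1-q}\right)^{\beta/(\beta-1)}\right)^{-1/(\beta-1)}>0.$$ Let $\psi\in C([-\bar\tau,0];(0,\infty))$. If the solution $x$ of $$x'(t)=-ag(x(t))+b\max_{t-\tau(t)\le s\le t}g(x(s)),\quad t\ge 0;\qquad x(t)=\psi(t),\quad t\in[-\bar\tau,0],$$ obeys $x(t)\to0$ as $t\to\infty$, and $G(x)=\int_x^1\frac{1}{g(u)}\,du$ for $x>0$, then there is $\Lambda_0>0$ such that $$0<\Lambda_0\le\liminf_{t\to\infty}\frac{G(x(t))}{t}\le\limsup_{t\to\infty}\frac{G(x(t))}{t}\le\Lambda^{-(\beta-1)}.$$ Moreover $$\Lambda\le\liminf_{t\to\infty}\frac{x(t)}{G^{-1}(t)}\le\limsup_{t\to\infty}\frac{x(t)}{G^{-1}(t)}<+\infty.$$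
   Context: A function $f$, positive near $0$ on the right, is regularly varying at zero with exponent $\alpha\in\mathbb{R}$, written $f\in\mathrm{RV}_0(\alpha)$, if $\lim_{t\to0^+}f(\lambda t)/f(t)=\lambda^\alpha$ for all $\lambda>0$. A solution of the equation is a continuous function $x:[-\bar\tau,\infty)\to(0,\infty)$, differentiable on $[0,\infty)$ (one-sided at $0$), satisfying the equation for all $t\ge0$ and equal to $\psi$ on $[-\bar\tau,0]$; solutions are positive. $G$ is strictly decreasing on $(0,\infty)$ with $G(x)\to\infty$ as $x\to0^+$, and $G^{-1}$ is its inverse. *)

(* Defs.v *)
From HB Require Import structures.
From mathcomp Require Import all_boot all_order all_algebra.
From mathcomp Require Import all_classical all_reals all_analysis.

Set Implicit Arguments.
Unset Strict Implicit.
Unset Printing Implicit Defensive.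

Import Order.TTheory GRing.Theory Num.Theory.
Import numFieldNormedType.Exports.

Local Open Scope classical_set_scope.
Local Open Scope ring_scope.

Definition RV0 (R : realType) (alpha : R) (f : R -> R) : Prop :=
  (\forall t \near 0^'+, 0 < f t) /\
  forall lambda : R, 0 < lambda ->
    f (lambda * t) / f t @[t --> 0^'+] --> lambda `^ alpha.

(* The greatest element of [A]; the junk value 0 is returned if [A] has none. *)
Definition setmax (R : realType) (A : set R) : R := xget 0 (A `&` ubound A).

Definition liminf_pinfty (R : realType) (f : R -> R) : \bar R :=
  limf_einf (fun t => (f t)%:E) (+oo_R).

Definition limsup_pinfty (R : realType) (f : R -> R) : \bar R :=
  limf_esup (fun t => (f t)%:E) (+oo_R).

(* Functions on a subset of the line are represented by total functions whose
   values off that subset are irrelevant. *)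

(* The delay bound; the initial interval is [- taubar tau, 0]. *)
Definition taubar (R : realType) (tau : R -> R) : R :=
  - inf [set t - tau t | t in `[0, +oo[].

Definition max_rhs (R : realType) (a b : R) (tau g x : R -> R) (t : R) : R :=
  - a * g (x t) + b * setmax [set g (x s) | s in `[t - tau t, t]].

(* The derivative at 0 is the right derivative: the two-sided one would also
   depend on the initial function. *)
Definition is_solution (R : realType) (a b : R) (tau g psi x : R -> R) : Prop :=
  [/\ {within `[- taubar tau, +oo[, continuous x},
      {in `[- taubar tau, +oo[, forall t, 0 < x t},
      {in `[- taubar tau, 0], forall t, x t = psi t},
      forall t : R, 0 < t -> is_derive t 1 x (max_rhs a b tau g x t) &
      (x t - x 0) / t @[t --> 0^'+] --> max_rhs a b tau g x 0].

(* The integral of 1/g from x to 1, oriented, hence the sign when 1 < x. *)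
Definition Gint (R : realType) (g : R -> R) (x : R) : R :=
  if x <= 1 then \int[lebesgue_measure]_(u in `[x, 1]) (g u)^-1
  else - \int[lebesgue_measure]_(u in `[1, x]) (g u)^-1.

(* The inverse of [Gint g : (0, oo) -> R] on its range. *)
Definition Ginv (R : realType) (g : R -> R) : R -> R :=
  pinv (`]0, +oo[ : set R) (Gint g).

Definition Lambda (R : realType) (a b q beta : R) : R :=
  (a - b * (1 / (1 - q)) `^ (beta / (beta - 1))) `^ (- (1 / (beta - 1))).

(* Main.v *)
Require Import Defs.
From HB Require Import structures.
From mathcomp Require Import all_boot all_order all_algebra.
From mathcomp Require Import all_classical all_reals all_analysis.
From mathcomp Require Import lra ring.

Set Implicit Arguments.
Unset Strict Implicit.
Unset Printing Implicit Defensive.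

Import Order.TTheory GRing.Theory Num.Theory.
Import numFieldNormedType.Exports.

Local Open Scope classical_set_scope.
Local Open Scope ring_scope.

(** Write [u = G (x)], where [G = Gint g]. As [G' = - 1 / g], the equation
    becomes [u' t = a - b * (max of g (x s) for t - tau t <= s <= t) / g (x t)],
    so that only a ratio of values of [g] matters. Two facts make that ratio
    computable from [u]. First, [G] is infinite at 0 ([Gint_cvgy]) and, by
    L'Hospital's rule, regularly varying there with exponent [1 - beta]
    ([Gint_RV0]). Secondly, [g] is monotone near 0; hence a bound on
    [G y / G x] bounds [y / x] and therefore [g y / g x]
    ([ge_g_of_Gint_le], [le_g_of_Gint_ge]). If [u] is linear, then
    [G (x (t - tau t)) / G (x t)] is about [1 - q], the ratio of the values of
    [g] is about [(1 / (1 - q)) ^ (beta / (beta - 1))], and the slope of [u] is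
    [C = a - b (1 / (1 - q)) ^ (beta / (beta - 1)) = Lambda ^ (- (beta - 1))].

    Upper bound on [u] ([Gint_solution_le]). If eventually [u t <= c t] with
    [c > C], then at a time when [u t] is close to [c t] the value of [u] at
    [t - tau t] is at most about [(1 - q) u t], so the delayed maximum is large
    and [u'] is at most about [C]. Therefore [u] cannot stay near the line of
    slope [c], and the slope improves by a fixed factor. Iteration brings it
    down to [C + e].

    Lower bound on [u] ([Gint_solution_ge]). A line of small positive slope
    starts below [u]. At a first contact all the past values of [u] lie above
    the line, which bounds the delayed maximum from above and makes [u] steeper
    than the line. Both bounds rest on the comparison lemma [barrier].

    The bounds on [x / Ginv] follow, since [Ginv g t] is the point [z] with
    [G z = t], and a linear bound on [G (x)] is a bound on [G (x) / G z], which
    regular variation converts into a bound on [x / z] ([solution_ge_Ginv],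
    [solution_le_Ginv]). *)

(** * Calculus on the line *)

Lemma near0r_ex (R : realType) (P : R -> Prop) :
  (\forall t \near 0^'+, P t) ->
  exists2 d : R, 0 < d & forall t, 0 < t -> t < d -> P t.
Proof.
case=> d /= d0 dP; exists d => // t t0 td; apply: dP => //=.
by rewrite sub0r normrN gtr0_norm.
Qed.

Lemma ex_near0r (R : realType) (P : R -> Prop) (d : R) : 0 < d ->
  (forall t, 0 < t -> t < d -> P t) -> \forall t \near 0^'+, P t.
Proof.
move=> d0 dP; near=> t; apply: dP; near: t.
  exact: nbhs_right_gt.
exact: nbhs_right_lt.
Unshelve. all: by end_near. Qed.

Lemma near0r_mono (R : realType) (P Q : R -> Prop) :
  (\forall t \near 0^'+, P t) -> (forall t, 0 < t -> P t -> Q t) ->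
  \forall t \near 0^'+, Q t.
Proof.
move=> /near0r_ex[d d0 dP] PQ; apply: (ex_near0r d0) => t t0 td.
by apply: PQ => //; exact: dP.
Qed.

Lemma is_derive1_continuous (R : realType) (f : R -> R) (x df : R) :
  is_derive x 1 f df -> {for x, continuous f}.
Proof.
by move=> fd; apply/differentiable_continuous/derivable1_diffP; case: fd.
Qed.

Lemma is_derive1_within (R : realType) (f df : R -> R) (i : interval R) :
  (forall x, x \in i -> is_derive x 1 f (df x)) ->
  {within [set` i], continuous f}.
Proof.
move=> fd; apply: derivable_within_continuous => x xi.
by case: (fd x xi).
Qed.

Lemma le_derive_increment (R : realType) (f df : R -> R) (s t k : R) :
  s <= t -> (forall u, s <= u <= t -> is_derive u 1 f (df u)) ->
  (forall u, s < u -> u < t -> df u <= k) -> f t - f s <= k * (t - s).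
Proof.
rewrite le_eqVlt => /predU1P[->|st] fd dfk; first by rewrite !subrr mulr0.
have [u||u] := @MVT _ f df s t st.
- by move=> /[!in_itv]/= /andP[su ut]; apply: fd; rewrite !ltW.
- by apply: (@is_derive1_within _ _ df) => u; rewrite in_itv/=; exact: fd.
- rewrite in_itv/= => /andP[su ut] ->.
  by apply: ler_wpM2r; [rewrite subr_ge0 ltW|exact: dfk].
Qed.

(** At the first zero [t] of [v] the values before [t] are negative, so that
    [v] cannot be decreasing at [t]. Only what precedes [t] is available in the
    hypothesis on [dv]: this is what delay equations require. *)
Lemma barrier (R : realType) (v dv : R -> R) (T : R) :
  (forall t, T <= t -> is_derive t 1 v (dv t)) -> v T < 0 ->
  (forall t, T < t -> (forall s, T <= s -> s < t -> v s < 0) -> v t = 0 ->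
    dv t < 0) ->
  forall t, T <= t -> v t < 0.
Proof.
move=> vd vT bar t2 Tt2; rewrite ltNge; apply/negP => vt2.
pose S := [set t | T <= t /\ 0 <= v t].
have Slb : lbound S T by move=> t [].
have Sinf : has_inf S by split; [exists t2|exists T].
set t := inf S.
have Tt : T <= t by apply: lb_le_inf => //; exists t2.
have before s : T <= s -> s < t -> v s < 0.
  move=> Ts st; rewrite ltNge; apply/negP => vs.
  suff : t <= s by rewrite leNgt st.
  by apply: ge_inf; [exists T|split].
have vc := is_derive1_continuous (vd t Tt).
have vt0 : 0 <= v t.
  rewrite leNgt; apply/negP => vt.
  have /nbhs_ballP[e /= e0 eP] : \forall s \near t, v s < 0.
    exact: (cvgr_lt _ vc).
  have [s [Ts vs] ste] : exists2 s, S s & s < t + e.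
    exact: inf_adherent.
  have ts : t <= s by apply: ge_inf => //; exists T.
  have : v s < 0.
    by apply: eP; rewrite /ball/= distrC ger0_norm ?subr_ge0// ltrBlDl.
  by rewrite ltNge vs.
have Ttlt : T < t.
  rewrite lt_neqAle Tt andbT; apply/eqP => Tt'.
  by move: vt0; rewrite -Tt' leNgt vT.
have left_of (P : R -> Prop) : (\forall s \near t, P s) ->
    exists s, [/\ T <= s, s < t & P s].
  move=> /nbhs_ballP[e /= e0 eP].
  exists (Num.max T (t - e / 2)); split; first by rewrite le_max lexx.
    by rewrite gt_max Ttlt/=; lra.
  apply: eP; rewrite /ball/= ger0_norm.
    rewrite ltrBlDl -ltrBlDr lt_max; apply/orP; right; lra.
  by rewrite subr_ge0 ge_max Tt/=; lra.
have vtE : v t = 0.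
  apply/eqP; rewrite eq_le vt0 andbT leNgt; apply/negP => vt.
  have [s [Ts st]] : exists s, [/\ T <= s, s < t & 0 < v s].
    apply: left_of; exact: (cvgr_gt _ vc).
  by rewrite ltNge ltW// before.
have dvt := bar t Ttlt before vtE.
have /is_derive1_caratheodory[h [vh hc hE]] := vd t Tt.
have [s [Ts st hs]] : exists s, [/\ T <= s, s < t & h s < 0].
  by apply: left_of; apply: (cvgr_lt _ hc); rewrite hE.
have := before s Ts st; have := vh s; rewrite vtE subr0 => -> /lt_geF.
by rewrite nmulr_rge0// subr_le0 ltW.
Qed.

(** A quantity that decreases at a fixed rate as long as it is nonnegative
    becomes negative, and it is then trapped by [barrier]. *)
Lemma decreasing_eventually_lt0 (R : realType) (v dv : R -> R) (T k : R) :
  (forall t, T <= t -> is_derive t 1 v (dv t)) -> 0 < k ->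
  (forall t, T <= t -> 0 <= v t -> dv t <= - k) ->
  exists2 T', T <= T' & forall t, T' <= t -> v t < 0.
Proof.
move=> vd k0 vk.
have [T1 TT1 vT1] : exists2 T1, T <= T1 & v T1 < 0.
  apply: contrapT => /forall2NP vge0.
  have v0 t : T <= t -> 0 <= v t.
    by move=> Tt; have [//|/negP] := vge0 t; rewrite -leNgt.
  pose t := T + (v T + 1) / k.
  have Tt : T <= t by rewrite lerDl divr_ge0 ?addr_ge0 ?v0// ltW.
  have : v t - v T <= - k * (t - T).
    apply: (@le_derive_increment _ _ dv) => // u; first by case/andP => *; exact: vd.
    by move=> /ltW Tu _; apply: vk => //; exact: v0.
  have -> : - k * (t - T) = - (v T + 1) by rewrite /t; field; rewrite gt_eqF.
  have := v0 t Tt; lra.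
exists T1 => //; apply: (@barrier _ v dv) => // [t T1t|t T1t _ vt].
  by apply: vd; exact: le_trans T1t.
apply: le_lt_trans (vk t _ _) _; rewrite ?vt ?oppr_lt0//.
by rewrite (le_trans TT1)// ltW.
Qed.

(** * Regular variation at zero *)

Lemma near0r_scale (R : realType) (P : R -> Prop) (l : R) : 0 < l ->
  (\forall t \near 0^'+, P t) -> \forall t \near 0^'+, P (l * t).
Proof.
move=> l0 /near0r_ex[d d0 dP]; apply: (@ex_near0r _ _ (d / l)).
  exact: divr_gt0.
move=> t t0 td; apply: dP; first exact: mulr_gt0.
by rewrite mulrC -ltr_pdivlMr.
Qed.

Lemma RV0_ge (R : realType) (alpha : R) (f : R -> R) (l k : R) :
  RV0 alpha f -> 0 < l -> k < l `^ alpha ->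
  \forall t \near 0^'+, k * f t <= f (l * t).
Proof.
move=> [f0 fl] l0 kl.
have near_ratio : \forall t \near 0^'+, k < f (l * t) / f t.
  exact: (cvgr_gt _ (fl l l0)).
move: f0 near_ratio; apply: filterS2 => t ft.
by rewrite ltr_pdivlMr// => /ltW.
Qed.

Lemma RV0_le (R : realType) (alpha : R) (f : R -> R) (l k : R) :
  RV0 alpha f -> 0 < l -> l `^ alpha < k ->
  \forall t \near 0^'+, f (l * t) <= k * f t.
Proof.
move=> [f0 fl] l0 kl.
have near_ratio : \forall t \near 0^'+, f (l * t) / f t < k.
  exact: (cvgr_lt _ (fl l l0)).
move: f0 near_ratio; apply: filterS2 => t ft.
by rewrite ltr_pdivrMr// => /ltW.
Qed.

Lemma RV0_from_bounds (R : realType) (alpha : R) (f : R -> R) :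
  (\forall t \near 0^'+, 0 < f t) ->
  (forall l k, 0 < l -> k < l `^ alpha ->
    \forall t \near 0^'+, k * f t <= f (l * t)) ->
  (forall l k, 0 < l -> l `^ alpha < k ->
    \forall t \near 0^'+, f (l * t) <= k * f t) ->
  RV0 alpha f.
Proof.
move=> f0 fge fle; split=> // l l0; apply/cvgrPdist_le => e e0.
have := fge l (l `^ alpha - e) l0; rewrite ltrBlDr ltrDl => /(_ e0) lo.
have := fle l (l `^ alpha + e) l0; rewrite ltrDl => /(_ e0) hi.
move: f0 lo hi; apply: filterS3 => t ft lo hi.
by rewrite distrC ler_distl ler_pdivlMr// lo/= ler_pdivrMr.
Qed.

Lemma nonincreasing_near0r (R : realType) (f df : R -> R) :
  (forall t : R, 0 < t -> is_derive t 1 f (df t)) ->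
  (\forall t \near 0^'+, df t <= 0) ->
  exists2 d, 0 < d & forall s t, 0 < s -> s <= t -> t < d -> f t <= f s.
Proof.
move=> fd /near0r_ex[d d0 dP]; exists d => // s t s0 st td.
rewrite -subr_le0 -[leRHS](mul0r (t - s)).
apply: (@le_derive_increment _ _ df) => // u.
  by case/andP => su _; apply: fd; exact: lt_le_trans su.
by move=> su ut; apply: dP; [exact: lt_trans su|exact: lt_trans td].
Qed.

(** * The primitive of 1/g *)

Section primitive.
Context (R : realType) (g : R -> R).
Hypothesis g_cont : forall u : R, 0 < u -> {for u, continuous g}.
Hypothesis g_gt0 : forall u : R, 0 < u -> 0 < g u.
Notation G := (Gint g).
Notation mu := (@lebesgue_measure R).

Let invg_cont (u : R) : 0 < u -> {for u, continuous (fun u => (g u)^-1)}.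
Proof. by move=> u0; apply: cvgV; [rewrite gt_eqF ?g_gt0|exact: g_cont]. Qed.

Let invg_integrable (c d : R) : 0 < c ->
  mu.-integrable `[c, d] (EFin \o (fun u => (g u)^-1)).
Proof.
move=> c0; apply: continuous_compact_integrable; first exact: segment_compact.
apply: continuous_in_subspaceT => u /[!inE]/=; rewrite in_itv/= => /andP[cu _].
by apply: invg_cont; exact: lt_le_trans cu.
Qed.

Lemma Gint_derive (x : R) : 0 < x -> is_derive x 1 G (- (g x)^-1).
Proof.
move=> x0.
pose c := Num.min x 1 / 2; pose d := Num.max x 1 + 1.
have c0 : 0 < c by rewrite divr_gt0// lt_min x0/=.
have [cx c1] : c < x /\ c < 1.
  by apply/andP; rewrite -lt_min /c; have : 0 < Num.min x 1; [rewrite lt_min x0/=|lra].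
have [xd d1] : x < d /\ 1 < d.
  by apply/andP; rewrite -gt_max /d ltrDl.
pose F (y : R) : R := \int[mu]_(t in `[c, y]) (g t)^-1.
have split_at a b : c < a -> a <= b -> b < d ->
    \int[mu]_(t in `[a, b]) (g t)^-1 = F b - F a.
  move=> ca ab bd; rewrite /F Rintegral_itvB//.
  - rewrite Rintegral_itv_obnd_cbnd//.
    apply: integrableS (@invg_integrable a b _) => //.
      exact: subset_itv_oc_cc.
    exact: lt_trans ca.
  - exact: invg_integrable.
  - by rewrite bnd_simp ltW.
have FE y : c < y -> y < d -> F 1 - F y = G y.
  move=> cy yd; rewrite /Gint; case: (leP y 1) => y1.
    by rewrite split_at.
  by rewrite split_at ?opprB// ltW.
have [Fd F'E] : derivable F x 1 /\ derive1 F x = (g x)^-1.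
  exact: (continuous_FTC1_closed xd (@invg_integrable c d c0) cx (invg_cont x0)).
clearbody F.
have FD : is_derive x 1 F (g x)^-1 by apply: DeriveDef; rewrite -?derive1E.
apply: (@near_eq_is_derive _ _ _ (fun y => F 1 - F y)).
  have xcd : x \in `]c, d[ by rewrite in_itv/= cx.
  near=> y; have : y \in `]c, d[ by near: y; exact: near_in_itvoo.
  by rewrite in_itv/= => /andP[cy yd]; exact: FE.
rewrite -[- _]sub0r; apply: is_deriveB.
Unshelve. all: by end_near. Qed.

Lemma Gint_lt (x y : R) : 0 < x -> x < y -> G y < G x.
Proof.
move=> x0 xy.
have Gd u : u \in `[x, y] -> is_derive u 1 G (- (g u)^-1).
  by rewrite in_itv/= => /andP[xu _]; apply: Gint_derive; exact: lt_le_trans xu.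
have Gc : {within `[x, y], continuous G} by exact: is_derive1_within Gd.
have Gdo u : u \in `]x, y[ -> is_derive u 1 G (- (g u)^-1).
  by move=> uxy; apply: Gd; exact: subset_itv_oo_cc uxy.
have [u uxy E] := MVT xy Gdo Gc.
have u0 : 0 < u by move: uxy; rewrite in_itv/= => /andP[xu _]; exact: lt_trans xu.
by rewrite -subr_lt0 E nmulr_rlt0 ?subr_gt0// oppr_lt0 invr_gt0 g_gt0.
Qed.

Lemma Gint_le (x y : R) : 0 < x -> 0 < y -> (G x <= G y) = (y <= x).
Proof.
move=> x0 y0; have [yx|xy] := leP y x.
  by move: yx; rewrite le_eqVlt => /predU1P[->|/(Gint_lt y0)/ltW]; rewrite ?lexx.
by apply/negbTE; rewrite -ltNge Gint_lt.
Qed.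

Lemma Gint_scale_derive (l x : R) : 0 < l -> 0 < x ->
  is_derive x 1 (fun t => G (l * t)) (- (l / g (l * x))).
Proof.
move=> l0 x0.
have lD : is_derive x 1 (fun t : R => l * t) l.
  by apply: is_derive_eq (is_deriveZ l (is_derive_id x 1)) _; rewrite /GRing.scale/= mulr1.
have GD := Gint_derive (mulr_gt0 l0 x0).
by apply: is_derive_eq (is_derive1_comp GD lD) _; rewrite mulNr mulrC.
Qed.

Section regular_variation.
Context (beta : R).
Hypothesis beta_gt1 : 1 < beta.
Hypothesis g_RV : RV0 beta g.

(** As [g (x / 2) <= g x / 2] near 0, the increment of [G] from [x] to [x / 2]
    does not decrease when [x] is halved. *)
Lemma Gint_cvgy : G x @[x --> 0^'+] --> +oo.
Proof.
have h0 : 0 < 2^-1 :> R by rewrite invr_gt0.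
have hlt : (2^-1 : R) `^ beta < 2^-1.
  have -> : beta = 1 + (beta - 1) by ring.
  rewrite powRD; last by rewrite (gt_eqF h0) implybT.
  rewrite powRr1 ?ltW// gtr_pMr//.
  suff : (2^-1 : R) `^ (beta - 1) < 1 `^ (beta - 1) by rewrite powR1.
  by apply: gt0_ltr_powR; rewrite ?nnegrE ?subr_gt0//; lra.
have [||d d0 dP] := @nonincreasing_near0r _ (fun x => G (2^-1 * x) - G x)
    (fun x => - (2^-1 / g (2^-1 * x)) - - (g x)^-1).
- by move=> x x0; apply: is_deriveB; [exact: Gint_scale_derive|exact: Gint_derive].
- apply: (near0r_mono (RV0_le g_RV h0 hlt)) => x x0 gx.
  rewrite opprK addrC subr_le0 -[leLHS]mul1r ler_pdivrMr ?g_gt0//.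
  by rewrite mulrAC ler_pdivlMr ?mul1r// g_gt0// mulr_gt0.
pose x0 := d / 2; have x00 : 0 < x0 by rewrite divr_gt0.
pose m := G (2^-1 * x0) - G x0.
have m0 : 0 < m.
  by rewrite subr_gt0 Gint_lt// ?mulr_gt0//; rewrite mulrC; lra.
have hn0 n : 0 < 2^-1 ^+ n * x0 by rewrite mulr_gt0// exprn_gt0.
have hn n : G x0 + n%:R * m <= G (2^-1 ^+ n * x0).
  elim: n => [|n IH]; first by rewrite expr0 mul1r mul0r addr0.
  have nx : 2^-1 ^+ n * x0 <= x0.
    by rewrite ger_pMl// exprn_ile1// ?invf_le1 ?ltW//; lra.
  have xd : x0 < d by rewrite /x0; lra.
  have := dP _ _ (hn0 n) nx xd.
  have -> : n.+1%:R * m = n%:R * m + m by rewrite -natr1 mulrDl mul1r.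
  rewrite -/m mulrA -exprS; lra.
apply/cvgryPge => A.
have [n An] : exists n, A <= G x0 + n%:R * m.
  exists (Num.truncn ((A - G x0) / m)).+1.
  by rewrite -lerBlDl -ler_pdivrMr// ltW// truncnS_gt.
apply: ex_near0r (hn0 n) _ => x xp xn; apply: le_trans An _.
by apply: le_trans (hn n) _; rewrite Gint_le// ltW.
Qed.

(** Where [f - k' G] is nonincreasing it is bounded below near 0, and a constant
    is negligible there because [G] is infinite at 0. *)
Let absorb (f df : R -> R) (k k' : R) :
  (forall t : R, 0 < t -> is_derive t 1 f (df t)) ->
  (\forall t \near 0^'+, df t + k' / g t <= 0) -> k < k' ->
  \forall t \near 0^'+, k * G t <= f t.
Proof.
move=> fd dfk kk'.
have [|//|d d0 dP] := @nonincreasing_near0r _ (fun x => f x - (k' *: G) x)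
    (fun x => df x - k' *: - (g x)^-1).
- move=> x x0; apply: is_deriveB; first exact: fd.
  apply: is_deriveZ; exact: Gint_derive.
- by move: dfk; apply: filterS => t; rewrite scalerN opprK.
pose x0 := d / 2; have x00 : 0 < x0 by rewrite divr_gt0.
pose m := f x0 - k' * G x0.
near=> t.
have t0 : 0 < t by near: t; exact: nbhs_right_gt.
have tx : t <= x0 by near: t; exact: nbhs_right_le.
have tG : - m <= (k' - k) * G t.
  rewrite mulrC -ler_pdivrMr ?subr_gt0//; near: t; exact: (cvgry_ge Gint_cvgy).
have xd : x0 < d by rewrite /x0; lra.
have := dP _ _ t0 tx xd; rewrite /GRing.scale/= -/m; rewrite -/m in tG.
change (f x0 - k' * G x0 <= f t - k' * G t -> k * G t <= f t).
rewrite -/m; lra.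
Unshelve. all: by end_near. Qed.

(** L'Hospital's rule for [G (l t) / G t] at 0. *)
Lemma Gint_RV0 : RV0 (1 - beta) G.
Proof.
have powE (l : R) : 0 < l -> l `^ beta = l / l `^ (1 - beta).
  move=> l0; have -> : beta = 1 - (1 - beta) by ring.
  rewrite (@powRB _ _ 1) ?(gt_eqF l0) ?implybT// powRr1 ?ltW//.
  by rewrite subKr.
apply: RV0_from_bounds => [|l k l0 kl|l k l0 lk].
- exact: (cvgry_gt Gint_cvgy).
- pose L := l `^ (1 - beta); pose k' := (Num.max k 0 + L) / 2.
  have L0 : 0 < L by exact: powR_gt0.
  have kL : Num.max k 0 < L by rewrite gt_max kl.
  have [k0 kk] : 0 <= Num.max k 0 /\ k <= Num.max k 0 by rewrite !le_max !lexx orbT.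
  have k'0 : 0 < k' by rewrite /k'; lra.
  apply: (@absorb _ (fun x => - (l / g (l * x))) k k') => [t t0||].
  + exact: Gint_scale_derive.
  + have lk' : l `^ beta < l / k'.
      by rewrite powE// ltr_pM2l// ltf_pV2 ?posrE// /k' -/L; lra.
    apply: (near0r_mono (RV0_le g_RV l0 lk')) => t t0 gt.
    have glt := g_gt0 (mulr_gt0 l0 t0); have gt0 := g_gt0 t0.
    rewrite addrC subr_le0 ler_pdivrMr// mulrAC ler_pdivlMr//.
    by move: gt; rewrite mulrAC ler_pdivlMr// mulrC.
  + by rewrite /k'; lra.
- pose L := l `^ (1 - beta); pose k' := (k + L) / 2.
  have L0 : 0 < L by exact: powR_gt0.
  have k'0 : 0 < k' by rewrite /k' -/L; rewrite -/L in lk; lra.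
  suff : \forall t \near 0^'+, - k * G t <= - G (l * t).
    by apply: filterS => t; rewrite mulNr lerN2.
  apply: (@absorb (\- (fun t => G (l * t))) (fun x => - - (l / g (l * x)))
      (- k) (- k')) => [t t0||].
  + by apply: is_deriveN; exact: Gint_scale_derive.
  + have lk' : l / k' < l `^ beta.
      by rewrite powE// ltr_pM2l// ltf_pV2 ?posrE// /k' -/L; rewrite -/L in lk; lra.
    apply: (near0r_mono (RV0_ge g_RV l0 lk')) => t t0 gt.
    have glt := g_gt0 (mulr_gt0 l0 t0); have gt0 := g_gt0 t0.
    rewrite opprK mulNr subr_le0 ler_pdivrMr// mulrAC ler_pdivlMr//.
    by move: gt; rewrite mulrAC ler_pdivrMr// [leRHS]mulrC.
  + by rewrite /k' ltrN2 -/L; rewrite -/L in lk; lra.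
Qed.

Section monotone.
Context (delta1 : R).
Hypothesis delta1_gt0 : 0 < delta1.
Hypothesis g_incr : {in `]0, delta1[ &, {homo g : u v / u <= v}}.

(** A small value of [G y / G x] forces [y] above a multiple [l x], and [g] is
    monotone: no estimate of the inverse of [G] is needed. *)
Lemma ge_g_of_Gint_le (l th k : R) :
  0 < l -> th < l `^ (1 - beta) -> k < l `^ beta ->
  exists2 d, 0 < d & forall x y : R, 0 < x -> x < d -> 0 < y -> y < d ->
    G y <= th * G x -> k * g x <= g y.
Proof.
move=> l0 thl kl.
have [d1 d10 d1P] := near0r_ex (RV0_ge Gint_RV0 l0 thl).
have [d2 d20 d2P] := near0r_ex (RV0_ge g_RV l0 kl).
exists (Num.min (Num.min d1 d2) delta1); first by rewrite !lt_min d10 d20.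
move=> x y x0; rewrite !lt_min => /andP[/andP[xd1 xd2] _] y0 /andP[_ yd] Gyx.
have lx0 := mulr_gt0 l0 x0.
have lxy : l * x <= y by rewrite -Gint_le// (le_trans Gyx)// d1P.
apply: le_trans (d2P x x0 xd2) _; apply: g_incr => //.
  by rewrite in_itv/= lx0/= (le_lt_trans lxy).
by rewrite in_itv/= y0.
Qed.

Lemma le_g_of_Gint_ge (l th k : R) :
  0 < l -> l `^ (1 - beta) < th -> l `^ beta < k ->
  exists2 d, 0 < d & forall x y : R, 0 < x -> x < d -> 0 < y -> y < d ->
    th * G x <= G y -> g y <= k * g x.
Proof.
move=> l0 thl kl.
have [d1 d10 d1P] := near0r_ex (RV0_le Gint_RV0 l0 thl).
have [d2 d20 d2P] := near0r_ex (RV0_le g_RV l0 kl).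
have [d3 d30 d3P] := near0r_ex (near0r_scale l0 (nbhs_right_lt delta1_gt0)).
exists (Num.min (Num.min d1 d2) d3); first by rewrite !lt_min d10 d20.
move=> x y x0; rewrite !lt_min => /andP[/andP[xd1 xd2] xd3] y0 _ Gyx.
have lx0 := mulr_gt0 l0 x0.
have lxd := d3P x x0 xd3.
have ylx : y <= l * x by rewrite -Gint_le// (le_trans _ Gyx)// d1P.
apply: le_trans (d2P x x0 xd2); apply: g_incr => //.
  by rewrite in_itv/= y0 (le_lt_trans ylx).
by rewrite in_itv/= lx0.
Qed.

End monotone.
End regular_variation.
End primitive.

(** * Limits at infinity *)

Lemma near_pinfty_ex (R : realType) (P : R -> Prop) :
  (\forall t \near +oo, P t) -> exists2 T : R, 0 < T & forall t, T <= t -> P t.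
Proof.
case=> M [_ MP]; exists (Num.max M 0 + 1).
  by rewrite ltr_wpDl// le_max lexx orbT.
move=> t Mt; apply: MP; apply: lt_le_trans Mt.
by rewrite ltr_pwDr// le_max lexx.
Qed.

Lemma ex_near_pinfty (R : realType) (P : R -> Prop) (T : R) :
  (forall t, T <= t -> P t) -> \forall t \near +oo, P t.
Proof.
by move=> TP; near=> t; apply: TP; near: t; apply: nbhs_pinfty_ge; rewrite num_real.
Unshelve. all: by end_near. Qed.

Lemma limsup_pinfty_le (R : realType) (f : R -> R) (L : R) :
  (forall e, 0 < e -> \forall t \near +oo, f t <= L + e) ->
  (limsup_pinfty f <= L%:E)%E.
Proof.
move=> fL; apply/lee_addgt0Pr => e e0; rewrite /limsup_pinfty limf_esupE.
apply: ge_ereal_inf; exists (ereal_sup [set (f t)%:E | t in [set t | f t <= L + e]]).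
  by exists [set t | f t <= L + e] => //; exact: fL.
by apply: ge_ereal_sup => _ [t /= ft <-]; rewrite -EFinD lee_fin.
Qed.

Lemma limsup_pinftyN (R : realType) (f : R -> R) :
  limsup_pinfty (fun t => - f t) = (- liminf_pinfty f)%E.
Proof.
by rewrite /limsup_pinfty /liminf_pinfty -limf_esupN.
Qed.

Lemma liminf_pinfty_ge (R : realType) (f : R -> R) (L : R) :
  (forall e, 0 < e -> \forall t \near +oo, L - e <= f t) ->
  (L%:E <= liminf_pinfty f)%E.
Proof.
move=> fL; rewrite -leeN2 -limsup_pinftyN -EFinN; apply: limsup_pinfty_le => e e0.
apply: filterS (fL e e0) => t; lra.
Qed.

Lemma liminf_le_limsup_pinfty (R : realType) (f : R -> R) :
  (liminf_pinfty f <= limsup_pinfty f)%E.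
Proof.
rewrite /liminf_pinfty /limf_einf; rewrite /limsup_pinfty !limf_esupE.
apply: le_ereal_inf_tmp => _ [A FA <-].
rewrite leeNl; apply: le_ereal_inf_tmp => _ [B FB <-].
have [t [At Bt]] : exists t, A t /\ B t.
  by apply: (@filter_ex _ (+oo_R)); exact: filterI.
apply: (@le_trans _ _ (- (f t)%:E)%E); last by apply: ereal_sup_ubound; exists t.
by rewrite leeN2; apply: ereal_sup_ubound; exists t.
Qed.

(** * Maxima over segments *)

Lemma setmax_segment (R : realType) (f : R -> R) (s t : R) : s <= t ->
  {within `[s, t], continuous f} ->
  let m := setmax [set f u | u in `[s, t]] in
  (exists2 c, s <= c <= t & m = f c) /\ forall u, s <= u <= t -> f u <= m.
Proof.
move=> st fc m.
have [c cst cmax] := EVT_max st fc.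
pose A := [set f u | u in `[s, t]].
have Pm : (A `&` ubound A) m.
  apply: (@xgetPex _ 0 (A `&` ubound A)); exists (f c); split; first by exists c.
  by move=> _ [u ust <-]; exact: cmax.
have [[c' c'st mE] mub] := Pm; split.
  by exists c' => //; move: c'st; rewrite /= in_itv.
by move=> u ust; apply: mub; exists u => //=; rewrite in_itv.
Qed.

(** * Powers *)

Lemma lt0_ltr_powR (R : realType) (r x y : R) :
  r < 0 -> 0 < x -> x < y -> y `^ r < x `^ r.
Proof.
move=> r0 x0 xy; have y0 := lt_trans x0 xy.
rewrite -[r]opprK !(powRN _ (- r)) ltf_pV2 ?posrE ?powR_gt0//.
by apply: gt0_ltr_powR; rewrite ?oppr_gt0 ?nnegrE ?ltW.
Qed.

Lemma powR_root (R : realType) (r m : R) : r != 0 -> 0 < m ->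
  (m `^ r^-1) `^ r = m.
Proof. by move=> r0 m0; rewrite -powRrM mulVf// powRr1// ltW. Qed.

(** * The inverse of the primitive *)

Section inverse_primitive.
Context (R : realType) (g : R -> R).
Hypothesis g_cont : forall u : R, 0 < u -> {for u, continuous g}.
Hypothesis g_gt0 : forall u : R, 0 < u -> 0 < g u.
Hypothesis G_cvgy : Gint g x @[x --> 0^'+] --> +oo.
Notation G := (Gint g).

Lemma Gint1 : G 1 = 0.
Proof. by rewrite /Gint lexx set_itv1 Rintegral_set1. Qed.

Lemma Gint_Ginv (t : R) : 0 <= t -> 0 < Ginv g t /\ G (Ginv g t) = t.
Proof.
move=> t0.
have [x x0 Gx] : exists2 x : R, 0 < x & G x = t.
  have [d d0 dP] := near0r_ex (cvgry_ge G_cvgy t).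
  pose y := Num.min d 1 / 2.
  have m0 : 0 < Num.min d 1 by rewrite lt_min d0/=.
  have [yd y1] : y < d /\ y < 1 by apply/andP; rewrite -lt_min /y; lra.
  have y0 : 0 < y by rewrite /y; lra.
  have tGy := dP y y0 yd.
  have [|||x] := @IVT _ G y 1 t.
  - exact: ltW.
  - apply: (@is_derive1_within _ _ (fun u => - (g u)^-1)) => u.
    rewrite in_itv/= => /andP[yu _]; apply: Gint_derive => //.
    exact: lt_le_trans yu.
  - by rewrite Gint1 ge_min t0 orbT le_max tGy.
  - rewrite in_itv/= => /andP[yx _] <-; exists x => //; exact: lt_le_trans yx.
have tim : [set G x | x in (`]0, +oo[ : set R)] t.
  by exists x => //=; rewrite in_itv/= x0.
split; last by rewrite /Ginv pinvK// inE.
have Gsurj : set_surj (`]0, +oo[ : set R) [set G x | x in (`]0, +oo[ : set R)] G.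
  by [].
have : [set` `]0, +oo[] (Ginv g t).
  by apply: (surjpinv_image_sub Gsurj); exists t.
by rewrite /= in_itv/= andbT.
Qed.

Lemma Ginv_lt (d : R) : 0 < d -> \forall t \near +oo, Ginv g t < d.
Proof.
move=> d0; apply: (@ex_near_pinfty _ _ (Num.max 0 (G d) + 1)) => t.
move=> dt; have [t0 Gdt] : 0 <= t /\ G d < t.
  have : 0 <= Num.max 0 (G d) by rewrite le_max lexx.
  have : G d <= Num.max 0 (G d) by rewrite le_max lexx orbT.
  lra.
have [z0 Gz] := Gint_Ginv t0.
by rewrite ltNge -(Gint_le g_cont g_gt0) // Gz -ltNge.
Qed.

End inverse_primitive.

(** * The delay equation *)

Section delay_equation.
Context (R : realType) (tau g x : R -> R) (q delta1 beta a b : R).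
Hypothesis tau_ge0 : forall t : R, 0 <= t -> 0 <= tau t.
Hypothesis tau_lim : t - tau t @[t --> +oo] --> +oo.
Hypothesis q_lt1 : q < 1.
Hypothesis tau_q : tau t / t @[t --> +oo] --> q.
Hypothesis g_cont : forall u : R, 0 < u -> {for u, continuous g}.
Hypothesis g_gt0 : forall u : R, 0 < u -> 0 < g u.
Hypothesis delta1_gt0 : 0 < delta1.
Hypothesis g_incr : {in `]0, delta1[ &, {homo g : u v / u <= v}}.
Hypothesis beta_gt1 : 1 < beta.
Hypothesis g_RV : RV0 beta g.
Hypothesis b_gt0 : 0 < b.
Hypothesis x_gt0 : forall t : R, 0 <= t -> 0 < x t.
Hypothesis x_derive : forall t : R, 0 < t ->
  is_derive t 1 x (max_rhs a b tau g x t).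
Hypothesis x_lim : x t @[t --> +oo] --> 0.

Notation G := (Gint g).
Let u (t : R) : R := G (x t).
Let M (t : R) : R := setmax [set g (x s) | s in `[t - tau t, t]].
Let du (t : R) : R := a - b * (M t / g (x t)).

(** The substitution [u = G (x)] removes the instantaneous term of the
    equation and leaves only the ratio of the delayed maximum to [g (x)]. *)
Let u_derive (t : R) : 0 < t -> is_derive t 1 u (du t).
Proof.
move=> t0; have xt := x_gt0 (ltW t0).
apply: is_derive_eq (is_derive1_comp (Gint_derive g_cont g_gt0 xt) (x_derive t0)) _.
by rewrite /max_rhs -/(M t) /du; field; rewrite gt_eqF// g_gt0.
Qed.

Let window_max (t : R) : 0 < t -> 0 < t - tau t ->
  (exists2 c, t - tau t <= c <= t & M t = g (x c)) /\
  forall s, t - tau t <= s <= t -> g (x s) <= M t.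
Proof.
move=> t0 tt0; apply: (@setmax_segment _ (fun s => g (x s))).
  by rewrite lerBlDr lerDl tau_ge0// ltW.
apply: continuous_in_subspaceT => s; rewrite inE/= in_itv/= => /andP[ts _].
have s0 : 0 < s by exact: lt_le_trans ts.
apply: (@continuous_comp _ _ _ x g); last exact: g_cont (x_gt0 (ltW s0)).
exact: is_derive1_continuous (x_derive s0).
Qed.

Let x_small (P : R -> Prop) :
  (\forall y \near 0^'+, P y) -> \forall t \near +oo, P (x t).
Proof.
move=> /near0r_ex[d d0 dP].
have xd : \forall t \near +oo, x t < d by exact: (cvgr_lt _ x_lim).
have [T T0 TP] := near_pinfty_ex xd.
apply: (@ex_near_pinfty _ _ T) => t Tt; apply: dP (TP t Tt).
by apply: x_gt0; rewrite (le_trans (ltW T0)).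
Qed.

Let delayed (P : R -> Prop) :
  (\forall t \near +oo, P t) -> \forall t \near +oo, P (t - tau t).
Proof.
move=> /near_pinfty_ex[T _ TP].
have tT : \forall t \near +oo, T <= t - tau t by exact: (cvgry_ge tau_lim).
have [T' _ T'P] := near_pinfty_ex tT.
by apply: (@ex_near_pinfty _ _ T') => t /T'P; exact: TP.
Qed.

Let near_gt0 : \forall t \near +oo, 0 < (t : R).
Proof. by apply: nbhs_pinfty_gt; rewrite num_real. Qed.

Let delay_le (r : R) : 1 - q < r -> \forall t \near +oo, t - tau t <= r * t.
Proof.
move=> qr.
have rq : 1 - r < q by lra.
have tq : \forall t \near +oo, 1 - r < tau t / t by exact: (cvgr_gt _ tau_q).
have [T T0 TP] := near_pinfty_ex tq.
apply: (@ex_near_pinfty _ _ T) => t Tt; have t0 := lt_le_trans T0 Tt.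
by have := TP t Tt; rewrite ltr_pdivlMr// mulrBl mul1r; lra.
Qed.

Let delay_ge (r : R) : r < 1 - q -> \forall t \near +oo, r * t <= t - tau t.
Proof.
move=> qr.
have rq : q < 1 - r by lra.
have tq : \forall t \near +oo, tau t / t < 1 - r by exact: (cvgr_lt _ tau_q).
have [T T0 TP] := near_pinfty_ex tq.
apply: (@ex_near_pinfty _ _ T) => t Tt; have t0 := lt_le_trans T0 Tt.
by have := TP t Tt; rewrite ltr_pdivrMr// mulrBl mul1r; lra.
Qed.

Let du_le (t k : R) : 0 < x t -> k * g (x t) <= M t -> du t <= a - b * k.
Proof.
move=> xt kM; rewrite lerD2l lerN2 ler_wpM2l ?(ltW b_gt0)//.
by rewrite ler_pdivlMr// g_gt0.
Qed.

(** The window contains its right endpoint, so that [u' <= a - b]; the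
    additional slope 1 absorbs the initial value. *)
Let u_le_linear : \forall t \near +oo, u t <= (a - b + 1) * t.
Proof.
have tail := delayed near_gt0.
have [T T0 TP] := near_pinfty_ex tail.
have [|||T1 _ T1P] := @decreasing_eventually_lt0 _
    (fun t => u t - (a - b + 1) * t) (fun t => du t - (a - b + 1)) T 1.
- move=> t Tt; apply: is_deriveB; first by apply: u_derive; exact: lt_le_trans Tt.
  by apply: is_derive_eq (is_deriveZ (a - b + 1) (is_derive_id t 1)) _;
    rewrite /GRing.scale/= mulr1.
- exact: ltr01.
- move=> t Tt _; have t0 := lt_le_trans T0 Tt; have xt := x_gt0 (ltW t0).
  have [_ gM] := window_max t0 (TP t Tt).
  have tt : t - tau t <= t <= t by rewrite lexx andbT lerBlDr lerDl tau_ge0// ltW.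
  have : du t <= a - b * 1 by apply: du_le => //; rewrite mul1r; exact: gM.
  rewrite mulr1; lra.
- by apply: (@ex_near_pinfty _ _ T1) => t /T1P; rewrite subr_lt0 => /ltW.
Qed.

(** An upper bound of slope [c] on [u] in the past makes [u] at the delayed
    time at most the fraction [th] of [u] at the present time, as long as [u]
    exceeds the line of slope [c']. Then [x] was larger by the factor [l], the
    delayed maximum is large, and the slope of [u] is less than [c']. *)
Let u_le_step (l th k r c c' : R) :
  0 < l -> 0 < th -> th < l `^ (1 - beta) -> k < l `^ beta -> 1 - q < r ->
  0 <= c -> c * r <= th * c' -> a - b * k < c' ->
  (\forall t \near +oo, u t <= c * t) -> \forall t \near +oo, u t <= c' * t.
Proof.
move=> l0 th0 thl kl qr c0 crc kc uc.
have [d d0 dP] := ge_g_of_Gint_le g_cont g_gt0 beta_gt1 g_RV delta1_gt0 g_incr l0 thl kl.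
have xd := x_small (nbhs_right_lt d0).
have ev : \forall t \near +oo, [/\ x t < d, x (t - tau t) < d, 0 < t - tau t,
    u (t - tau t) <= c * (t - tau t) & t - tau t <= r * t].
  move: (delayed xd) (delayed near_gt0) (delayed uc) (delay_le qr) => xd' pos' uc' rt.
  by near=> t; split; near: t.
have [T T0 TP] := near_pinfty_ex ev.
have [|||T1 _ T1P] := @decreasing_eventually_lt0 _
    (fun t => u t - c' * t) (fun t => du t - c') T (c' - (a - b * k)).
- move=> t Tt; apply: is_deriveB; first by apply: u_derive; exact: lt_le_trans Tt.
  by apply: is_derive_eq (is_deriveZ c' (is_derive_id t 1)) _;
    rewrite /GRing.scale/= mulr1.
- by rewrite subr_gt0.
- move=> t Tt; rewrite subr_ge0 => ct.
  have t0 := lt_le_trans T0 Tt; have xt := x_gt0 (ltW t0).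
  have [xtd xsd s0 us sr] := TP t Tt.
  have [_ gM] := window_max t0 s0.
  have ss : t - tau t <= t - tau t <= t.
    by rewrite lexx/= lerBlDr lerDl tau_ge0// ltW.
  have uth : u (t - tau t) <= th * u t.
    apply: (le_trans us); apply: (@le_trans _ _ (c * (r * t))).
      exact: ler_wpM2l.
    rewrite mulrA; apply: (@le_trans _ _ (th * c' * t)).
      by apply: ler_wpM2r => //; exact: ltW.
    by rewrite -mulrA; apply: ler_wpM2l => //; exact: ltW.
  have kg := dP _ _ xt xtd (x_gt0 (ltW s0)) xsd uth.
  have := du_le xt (le_trans kg (gM _ ss)); lra.
- by apply: (@ex_near_pinfty _ _ T1) => t /T1P; rewrite subr_lt0 => /ltW.
Unshelve. all: by end_near. Qed.

(** The factor by which [x] was larger at the delayed time if [u] is linear: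
    [G] scales with the exponent [1 - beta], and time scales by [1 - q]. *)
Let l0 : R := (1 / (1 - q)) `^ (beta - 1)^-1.

Let l0_gt0 : 0 < l0.
Proof. by apply: powR_gt0; rewrite divr_gt0// subr_gt0. Qed.

Let l0_beta : l0 `^ beta = (1 / (1 - q)) `^ (beta / (beta - 1)).
Proof. by rewrite -powRrM [_ * beta]mulrC. Qed.

Let l0_1beta : l0 `^ (1 - beta) = 1 - q.
Proof.
rewrite -opprB powRN powR_root ?div1r ?invrK ?invr_gt0 ?subr_gt0//.
by rewrite gt_eqF// subr_gt0.
Qed.

Let beta_gt0 : 0 < beta. Proof. by apply: lt_trans beta_gt1. Qed.

(** Since [l0 ^ beta] is the limiting ratio of the values of [g], a smaller or a
    larger ratio [m] comes from a scale [l] on the same side of [l0], and its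
    power [l ^ (1 - beta)] lies strictly on the opposite side of [1 - q]. This
    leaves room for the error terms. *)
Let scale_lt (m : R) : 0 < m -> m < l0 `^ beta ->
  exists l, [/\ 0 < l, l `^ beta = m & 1 - q < l `^ (1 - beta)].
Proof.
move=> m0 ml0; exists (m `^ beta^-1).
have lb : (m `^ beta^-1) `^ beta = m by rewrite powR_root ?gt_eqF.
split; [exact: powR_gt0|exact: lb|].
rewrite -l0_1beta; apply: lt0_ltr_powR; rewrite ?subr_lt0 ?powR_gt0//.
rewrite ltNge; apply/negP => le; move: ml0; rewrite ltNge -lb => /negP; apply.
by apply: ge0_ler_powR; rewrite ?nnegrE ?powR_ge0// ltW.
Qed.

Let scale_gt (m : R) : l0 `^ beta < m ->
  exists l, [/\ 0 < l, l `^ beta = m & l `^ (1 - beta) < 1 - q].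
Proof.
move=> ml0; have m0 : 0 < m by apply: le_lt_trans ml0; exact: powR_ge0.
exists (m `^ beta^-1).
have lb : (m `^ beta^-1) `^ beta = m by rewrite powR_root ?gt_eqF.
split; [exact: powR_gt0|exact: lb|].
rewrite -l0_1beta; apply: lt0_ltr_powR; rewrite ?subr_lt0//.
rewrite ltNge; apply/negP => le; move: ml0; rewrite ltNge -lb => /negP; apply.
by apply: ge0_ler_powR; rewrite ?nnegrE ?powR_ge0// ltW.
Qed.

Let C : R := a - b * (1 / (1 - q)) `^ (beta / (beta - 1)).
Hypothesis C_gt0 : 0 < C.

(** Each application of [u_le_step] multiplies the slope by a ratio [r / th]
    smaller than 1 that depends on [e] only, until [C + e] is reached. *)
Lemma Gint_solution_le (e : R) : 0 < e ->
  \forall t \near +oo, G (x t) <= (C + e) * t.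
Proof.
move=> e0.
have L0 : 0 < l0 `^ beta by exact: powR_gt0.
have CE : C = a - b * l0 `^ beta by rewrite l0_beta.
(* With this [k], [a - b * k = C + e / 2]; [m] has to be positive, [k] need not. *)
pose k := l0 `^ beta - e / (2 * b).
pose m := (Num.max k 0 + l0 `^ beta) / 2.
have eb : 0 < e / (2 * b) by rewrite divr_gt0// mulr_gt0.
have kL : Num.max k 0 < l0 `^ beta by rewrite gt_max L0 andbT /k; lra.
have [kmax max0] : k <= Num.max k 0 /\ 0 <= Num.max k 0.
  by rewrite !le_max !lexx orbT.
have [m0 km ml0] : [/\ 0 < m, k < m & m < l0 `^ beta] by rewrite /m; split; lra.
have [l [lp lm lq]] := scale_lt m0 ml0.
pose th := ((1 - q) + l `^ (1 - beta)) / 2.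
pose r := ((1 - q) + th) / 2.
have [qth thl] : 1 - q < th /\ th < l `^ (1 - beta) by rewrite /th; split; lra.
have [qr rth] : 1 - q < r /\ r < th by rewrite /r; split; lra.
have q1 : 0 < 1 - q by rewrite subr_gt0.
have th0 : 0 < th by exact: lt_trans qth.
have kC : a - b * k < C + e.
  rewrite CE /k mulrBr.
  have -> : b * (e / (2 * b)) = e / 2 by field; rewrite gt_eqF.
  lra.
have r0 : 0 < r by exact: lt_trans qr.
pose rho := r / th.
have rho0 : 0 < rho by exact: divr_gt0.
have rho1 : rho < 1 by rewrite ltr_pdivrMr// mul1r.
pose c n : R := Num.max (rho ^+ n * (a - b + 1)) (C + e).
have c_gt0 n : 0 < c n by rewrite lt_max addr_gt0// orbT.
have uc n : \forall t \near +oo, u t <= c n * t.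
  elim: n => [|n IH].
    have [T T0 TP] := near_pinfty_ex u_le_linear.
    apply: (@ex_near_pinfty _ _ T) => t Tt; apply: le_trans (TP t Tt) _.
    apply: ler_wpM2r; first by rewrite ltW// (lt_le_trans T0).
    by rewrite /c expr0 mul1r le_max lexx.
  apply: (@u_le_step l th k r (c n)) => //.
  - by rewrite lm.
  - exact: ltW.
  - have -> : c n * r = th * (rho * c n) by rewrite /rho; field; rewrite gt_eqF.
    rewrite ler_wpM2l ?(ltW th0)// /c maxr_pMr ?(ltW rho0)// mulrA -exprS.
    rewrite ge_max !le_max lexx/=; apply/orP; right.
    have Ce := addr_gt0 C_gt0 e0.
    by rewrite -[leRHS]mul1r; apply: ler_wpM2r; exact: ltW.
  - by apply: (lt_le_trans kC); rewrite le_max lexx orbT.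
have [n cn] : exists n, c n = C + e.
  have rho_cvg : rho ^+ n * (a - b + 1) @[n --> \oo] --> 0 * (a - b + 1).
    by apply: cvgMl; apply: cvg_expr; rewrite gtr0_norm.
  rewrite mul0r in rho_cvg.
  have [N _ NP] : \forall n \near \oo, rho ^+ n * (a - b + 1) < C + e.
    by apply: (cvgr_lt _ rho_cvg); exact: addr_gt0.
  by exists N; rewrite /c; apply/max_idPr/ltW/NP => /=.
by have := uc n; rewrite cn.
Qed.

(** A line of small positive slope through the origin lies below [u] up to the
    time when the asymptotic estimates become valid. Where [u] would first touch
    it, the past values of [u] lie above it, so that the delayed maximum is at
    most [k g (x)] with [k < a / b], and [u] is steeper than the line. *)
Lemma Gint_solution_ge :
  exists2 c, 0 < c & \forall t \near +oo, c * t <= G (x t).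
Proof.
have La : l0 `^ beta < a / b.
  by rewrite ltr_pdivlMr// mulrC l0_beta -subr_gt0.
(* [C > 0] leaves the gap between [l0 `^ beta] and [a / b] that holds [m], [k]. *)
pose m := (l0 `^ beta + a / b) / 2; pose k := (m + a / b) / 2.
have [ml0 mk kab] : [/\ l0 `^ beta < m, m < k & k < a / b].
  by rewrite /k /m; split; lra.
have [l [lp lm lq]] := scale_gt ml0.
pose th := ((1 - q) + l `^ (1 - beta)) / 2.
have lth : l `^ (1 - beta) < th by rewrite /th; lra.
have thq : th < 1 - q by rewrite /th; lra.
have th0 : 0 < th by apply: le_lt_trans lth; exact: powR_ge0.
have mk' : l `^ beta < k by rewrite lm.
have [d d0 dP] := le_g_of_Gint_ge g_cont g_gt0 beta_gt1 g_RV delta1_gt0 g_incr lp lth mk'.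
have ev0 : \forall t \near +oo, x t < d /\ 1 <= u t.
  move: (x_small (nbhs_right_lt d0)) => xd.
  have G1 : \forall y \near 0^'+, 1 <= G y.
    exact: (cvgry_ge (Gint_cvgy g_cont g_gt0 beta_gt1 g_RV)).
  have u1 := x_small G1.
  by near=> t; split; near: t.
have [T0 T00 T0P] := near_pinfty_ex ev0.
have ev1 : \forall t \near +oo, T0 <= t - tau t /\ th * t <= t - tau t.
  have tT : \forall t \near +oo, T0 <= t - tau t by exact: (cvgry_ge tau_lim).
  move: (delay_ge thq) => tht.
  by near=> t; split; near: t.
have [T1 T10 T1P] := near_pinfty_ex ev1.
have T01 : T0 <= T1.
  apply: le_trans (T1P T1 (lexx _)).1 _.
  by rewrite lerBlDr lerDl tau_ge0// ltW.
have ak : 0 < a - b * k by rewrite subr_gt0 mulrC -ltr_pdivlMr.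
(* The first bound makes the line flatter than [u] at a contact, the second one
   keeps it below 1, hence below [u], up to [T1]. *)
pose c := Num.min ((a - b * k) / 2) ((2 * T1)^-1).
have c0 : 0 < c.
  by rewrite lt_min; apply/andP; split; rewrite ?divr_gt0 ?invr_gt0 ?mulr_gt0.
have ck : c < a - b * k.
  have : c <= (a - b * k) / 2 by rewrite ge_min lexx.
  lra.
have cT1 : c * T1 <= 2^-1.
  have : c <= (2 * T1)^-1 by rewrite ge_min lexx orbT.
  by rewrite invfM -ler_pdivlMr// invrK.
have early s : T0 <= s -> s <= T1 -> c * s < u s.
  move=> Ts sT; apply: lt_le_trans (T0P s Ts).2.
  have : c * s <= c * T1 by rewrite ler_wpM2l// ltW.
  lra.
exists c => //.
have below t : T1 <= t -> c * t - u t < 0.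
  apply: (@barrier _ (fun t => c * t - u t) (fun t => c - du t)).
  - move=> {}t Tt; apply: is_deriveB; last by apply: u_derive; exact: lt_le_trans Tt.
    by apply: is_derive_eq (is_deriveZ c (is_derive_id t 1)) _;
      rewrite /GRing.scale/= mulr1.
  - by rewrite subr_lt0; exact: early.
  - move=> {}t Tt past /eqP; rewrite subr_eq0 => /eqP ut.
    have t0 := lt_trans T10 Tt; have xt := x_gt0 (ltW t0).
    have [Tt' tht] := T1P t (ltW Tt).
    have [[s /andP[ts st] Ms] _] := window_max t0 (lt_le_trans T00 Tt').
    have Ts := le_trans Tt' ts.
    have cs : c * s <= u s.
      have [sT1|T1s] := leP s T1; first by rewrite ltW// early.
      move: st; rewrite le_eqVlt => /predU1P[->|st]; first by rewrite ut.
      by have := past s (ltW T1s) st; rewrite subr_lt0 => /ltW.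
    have uth : th * u t <= u s.
      apply: le_trans cs; rewrite -ut mulrCA ler_wpM2l ?(ltW c0)//.
      exact: le_trans ts.
    have s0 := lt_le_trans T00 Ts.
    have gk : M t <= k * g (x t).
      rewrite Ms; apply: dP uth => //; first exact: (T0P t (le_trans T01 (ltW Tt))).1.
        exact: x_gt0 (ltW s0).
      exact: (T0P s Ts).1.
    have : a - b * k <= du t.
      rewrite lerD2l lerN2 ler_wpM2l ?(ltW b_gt0)//.
      by rewrite ler_pdivrMr// g_gt0.
    lra.
apply: (@ex_near_pinfty _ _ T1) => t /below; rewrite subr_lt0; exact: ltW.
Unshelve. all: by end_near. Qed.

Let z_RV (P : R -> Prop) :
  (\forall y \near 0^'+, P y) -> \forall t \near +oo, P (Ginv g t).
Proof.
move=> /near0r_ex[d d0 dP].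
have Gy := Gint_cvgy g_cont g_gt0 beta_gt1 g_RV.
have [T T0 TP] := near_pinfty_ex (Ginv_lt g_cont g_gt0 Gy d0).
apply: (@ex_near_pinfty _ _ T) => t Tt; apply: dP (TP t Tt).
by apply: (Gint_Ginv g_cont g_gt0 Gy _).1; rewrite ltW// (lt_le_trans T0).
Qed.

(** Linear bounds on [G (x)] become bounds on [x / Ginv] because [G] is
    regularly varying: [G (l z)] is about [l ^ (1 - beta) G z]. *)
Lemma solution_ge_Ginv (l c : R) : 0 < l -> c < l `^ (1 - beta) ->
  (\forall t \near +oo, G (x t) <= c * t) ->
  \forall t \near +oo, l <= x t / Ginv g t.
Proof.
move=> lp cl uc.
have Gy := Gint_cvgy g_cont g_gt0 beta_gt1 g_RV.
have Gl := z_RV (RV0_ge (Gint_RV0 g_cont g_gt0 beta_gt1 g_RV) lp cl).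
have [T T0 TP] := near_pinfty_ex uc.
have [T' T'0 T'P] := near_pinfty_ex Gl.
apply: (@ex_near_pinfty _ _ (Num.max T T')) => t.
rewrite ge_max => /andP[Tt Tt']; have t0 := lt_le_trans T0 Tt.
have [z0 Gz] := Gint_Ginv g_cont g_gt0 Gy (ltW t0).
rewrite ler_pdivlMr// -(Gint_le g_cont g_gt0) ?mulr_gt0// ?x_gt0 ?(ltW t0)//.
by apply: le_trans (TP t Tt) _; have := T'P t Tt'; rewrite Gz.
Qed.

Lemma solution_le_Ginv (l c : R) : 0 < l -> l `^ (1 - beta) < c ->
  (\forall t \near +oo, c * t <= G (x t)) ->
  \forall t \near +oo, x t / Ginv g t <= l.
Proof.
move=> lp cl uc.
have Gy := Gint_cvgy g_cont g_gt0 beta_gt1 g_RV.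
have Gl := z_RV (RV0_le (Gint_RV0 g_cont g_gt0 beta_gt1 g_RV) lp cl).
have [T T0 TP] := near_pinfty_ex uc.
have [T' T'0 T'P] := near_pinfty_ex Gl.
apply: (@ex_near_pinfty _ _ (Num.max T T')) => t.
rewrite ge_max => /andP[Tt Tt']; have t0 := lt_le_trans T0 Tt.
have [z0 Gz] := Gint_Ginv g_cont g_gt0 Gy (ltW t0).
rewrite ler_pdivrMr// -(Gint_le g_cont g_gt0) ?mulr_gt0// ?x_gt0 ?(ltW t0)//.
by apply: le_trans (TP t Tt); have := T'P t Tt'; rewrite Gz.
Qed.

End delay_equation.

(** By convention [inf] is 0 if the delayed times are unbounded below. *)
Lemma taubar_ge0 (R : realType) (tau : R -> R) :
  (forall t : R, 0 <= t -> 0 <= tau t) -> 0 <= taubar tau.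
Proof.
move=> tau_ge0; rewrite /taubar oppr_ge0.
have [infS|noinf] := pselect (has_inf [set t - tau t | t in `[0, +oo[]); last first.
  by rewrite inf_out.
apply: (@le_trans _ _ (0 - tau 0)); last by rewrite sub0r oppr_le0 tau_ge0.
by apply: ge_inf; [case: infS|exists 0 => //=; rewrite in_itv/= lexx].
Qed.

Theorem theorem22 (R : realType) (tau : R -> R) (q : R) (g : R -> R)
    (delta1 beta a b : R) (psi x : R -> R)
    (tau_cont : {within `[0, +oo[, continuous tau})
    (tau_ge0 : forall t : R, 0 <= t -> 0 <= tau t)
    (tau_lim : t - tau t @[t --> +oo] --> +oo)
    (q_gt0 : 0 < q) (q_lt1 : q < 1)
    (tau_q : tau t / t @[t --> +oo] --> q)
    (g_cont : {within `[0, +oo[, continuous g})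
    (g0 : g 0 = 0)
    (g_gt0 : forall u : R, 0 < u -> 0 < g u)
    (delta1_gt0 : 0 < delta1)
    (g_incr : {in `]0, delta1[ &, {homo g : u v / u <= v}})
    (beta_gt1 : 1 < beta)
    (g_RV : RV0 beta g)
    (b_gt0 : 0 < b) (ab : b < a)
    (ab_q : b * (1 / (1 - q)) `^ (beta / (beta - 1)) < a)
    (psi_cont : {within `[- taubar tau, 0], continuous psi})
    (psi_gt0 : {in `[- taubar tau, 0], forall t : R, 0 < psi t})
    (x_sol : is_solution a b tau g psi x)
    (x_lim : x t @[t --> +oo] --> 0) :
  (exists Lambda0 : R,
    [/\ 0 < Lambda0,
        (Lambda0%:E <= liminf_pinfty (fun t : R => (Gint g (x t) / t)%R))%E,
        (liminf_pinfty (fun t : R => (Gint g (x t) / t)%R)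
          <= limsup_pinfty (fun t : R => (Gint g (x t) / t)%R))%E &
        (limsup_pinfty (fun t : R => (Gint g (x t) / t)%R)
          <= (Lambda a b q beta `^ (- (beta - 1)))%:E)%E]) /\
  [/\ ((Lambda a b q beta)%:E <= liminf_pinfty (fun t : R => (x t / Ginv g t)%R))%E,
      (liminf_pinfty (fun t : R => (x t / Ginv g t)%R)
        <= limsup_pinfty (fun t : R => (x t / Ginv g t)%R))%E &
      (limsup_pinfty (fun t : R => (x t / Ginv g t)%R) < +oo)%E].
Proof.
have gc (u : R) : 0 < u -> {for u, continuous g}.
  move=> u0; apply: (@within_continuous_continuous _ _ _ 0 (u + 1)).
  - by rewrite addr_gt0.
  - apply: continuous_subspaceW g_cont => v /=; rewrite !in_itv/= andbT.
    by case/andP.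
  - by rewrite in_itv/= u0 ltrDl ltr01.
case: x_sol => _ x_pos _ x_der _.
have x_gt0 (t : R) : 0 <= t -> 0 < x t.
  move=> t0; apply: x_pos; rewrite in_itv/= andbT.
  by apply: le_trans t0; rewrite oppr_le0 taubar_ge0.
pose C := a - b * (1 / (1 - q)) `^ (beta / (beta - 1)).
have C0 : 0 < C by rewrite subr_gt0.
have b1 : 0 < beta - 1 by rewrite subr_gt0.
have LC : Lambda a b q beta `^ (- (beta - 1)) = C.
  rewrite /Lambda -/C -powRrM mulrNN div1r mulVf ?gt_eqF// powRr1//.
  exact: ltW.
have L0 : 0 < Lambda a b q beta by exact: powR_gt0.
have Gle := Gint_solution_le tau_ge0 tau_lim q_lt1 tau_q gc g_gt0 delta1_gt0
  g_incr beta_gt1 g_RV b_gt0 x_gt0 x_der x_lim C0.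
have [c0 c00 Gge] := Gint_solution_ge tau_ge0 tau_lim q_lt1 tau_q gc g_gt0
  delta1_gt0 g_incr beta_gt1 g_RV b_gt0 x_gt0 x_der x_lim C0.
split.
  exists c0; split=> //.
  - apply: liminf_pinfty_ge => e e0.
    have [T T0 TP] := near_pinfty_ex Gge.
    apply: (@ex_near_pinfty _ _ T) => t Tt; have t0 := lt_le_trans T0 Tt.
    rewrite ler_pdivlMr//; apply: le_trans (TP t Tt).
    by rewrite ler_wpM2r ?(ltW t0)// gerBl ltW.
  - exact: liminf_le_limsup_pinfty.
  - rewrite LC; apply: limsup_pinfty_le => e e0.
    have [T T0 TP] := near_pinfty_ex (Gle e e0).
    apply: (@ex_near_pinfty _ _ T) => t Tt; have t0 := lt_le_trans T0 Tt.
    by rewrite ler_pdivrMr//; exact: TP.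
have nb : 1 - beta < 0 by rewrite subr_lt0.
split.
- apply: liminf_pinfty_ge => e e0.
  (* A positive scale is required, whereas [Lambda - e] may be negative. *)
  pose l := Num.max (Lambda a b q beta - e) (Lambda a b q beta / 2).
  have l0 : 0 < l by rewrite lt_max divr_gt0// orbT.
  have lL : l < Lambda a b q beta.
    by rewrite gt_max; apply/andP; split; lra.
  have Cl : C < l `^ (1 - beta).
    by rewrite -LC opprB; exact: lt0_ltr_powR.
  pose e' := (l `^ (1 - beta) - C) / 2.
  have e'0 : 0 < e' by rewrite divr_gt0// subr_gt0.
  have Cel : C + e' < l `^ (1 - beta) by rewrite /e'; lra.
  have lx := solution_ge_Ginv gc g_gt0 beta_gt1 g_RV x_gt0 l0 Cel (Gle e' e'0).
  have [T T0 TP] := near_pinfty_ex lx.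
  apply: (@ex_near_pinfty _ _ T) => t Tt; apply: le_trans (TP t Tt).
  by rewrite le_max lexx.
- exact: liminf_le_limsup_pinfty.
- pose l := (c0 / 2) `^ (1 - beta)^-1.
  have c20 : 0 < c0 / 2 by rewrite divr_gt0.
  have l0 : 0 < l by exact: powR_gt0.
  have lc : l `^ (1 - beta) < c0.
    by rewrite /l powR_root ?lt_eqF//; lra.
  have xl := solution_le_Ginv gc g_gt0 beta_gt1 g_RV x_gt0 l0 lc Gge.
  apply: (@le_lt_trans _ _ l%:E); last exact: ltry.
  apply: limsup_pinfty_le => e e0.
  have [T T0 TP] := near_pinfty_ex xl.
  apply: (@ex_near_pinfty _ _ T) => t Tt; apply: le_trans (TP t Tt) _.
  by rewrite lerDl ltW.
Qed.
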